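(* If $\alpha,\beta\in\mathbb{R}\setminus\mathbb{Q}$ and $\alpha_{\ge m}=\beta_{\ge n}$ for some $m,n\in\mathbb{N}$, then $\alpha$ and $\beta$ have the same type, i.e. $\tau(\alpha)=\tau(\beta)$.
   Context: $\mathbb{N}$ includes $0$. For real $x$, $\|x\|:=\min_{k\in\mathbb{Z}}|x-k|$ denotes the distance from $x$ to the nearest integer. For an irrational real number $\alpha$, the type of $\alpha$ is $$\tau(\alpha):=\sup\big\{\theta\in\mathbb{R}:\liminf_{q\to\infty,\ q\in\mathbb{N}} q^\theta\|q\alpha\|=0\big\}\in[1,\infty].$$ Each irrational $\alpha$ has a unique infinite simple continued fraction expansion $\alpha=[a_0;a_1,a_2,\ldots]$ with $a_0\in\mathbb{Z}$ and $a_i$ a positive integer for $i\ge1$. The $n$-th tail of $\alpha$ is the irrational number $\alpha_{\ge n}:=[a_n;a_{n+1},a_{n+2},\ldots]$. *)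

(* Defs.v *)
From HB Require Import structures.
From mathcomp Require Import all_boot all_order all_algebra.
From mathcomp Require Import ring lra.
From mathcomp Require Import all_classical all_reals all_analysis.

Set Implicit Arguments.
Unset Strict Implicit.
Unset Printing Implicit Defensive.

Import Order.TTheory GRing.Theory Num.Theory.
Import numFieldNormedType.Exports.

Local Open Scope classical_set_scope.
Local Open Scope ring_scope.

Definition dist_int (R : realType) (x : R) : R :=
  inf (range (fun k : int => `|x - k%:~R|)).

Definition irr_type (R : realType) (alpha : R) : \bar R :=
  ereal_sup [set theta%:E | theta in [set theta : R |
    limn_einf (fun q : nat =>
      (q%:R `^ theta * dist_int (q%:R * alpha))%:E) = 0%E]].

(* The finite continued fraction [a_0; a_1, ..., a_n]. *)
Fixpoint convergent (R : realType) (a : nat -> int) (n : nat) : R :=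
  if n is m.+1 then (a 0%N)%:~R + (convergent R (fun i => a i.+1) m)^-1
  else (a 0%N)%:~R.

Definition is_simple_cf (a : nat -> int) : Prop := forall i : nat, 0 < a i.+1.

Definition cf_value (R : realType) (a : nat -> int) : R :=
  limn (convergent R a).

Definition is_cf_expansion (R : realType) (a : nat -> int) (x : R) : Prop :=
  is_simple_cf a /\ convergent R a @ \oo --> x.

(* Junk value for rational x; for irrational x it is the unique sequence with
   is_cf_expansion a x (cf_expansionP, cf_expansion_unique). *)
Definition cf_expansion (R : realType) (x : R) : nat -> int :=
  xget (fun=> 0) [set a | is_cf_expansion a x].

Definition cf_tail (R : realType) (x : R) (n : nat) : R :=
  cf_value R (fun i => cf_expansion x (n + i)%N).

Lemma dist_int_min (R : realType) (x : R) :
  (exists k : int, dist_int x = `|x - k%:~R|) /\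
  (forall k : int, dist_int x <= `|x - k%:~R|).
Proof.
have lbd (k : int) : dist_int x <= `|x - k%:~R|.
  by apply: ge_inf; [exists 0 => _ [j _ <-] | exists k].
split=> //.
have h1 := floor_le x; have h2 := floorD1_gt x.
rewrite intrD in h2; have {}h2 : x < (Num.floor x)%:~R + 1 := h2.
have [k kmin] : exists k : int, forall j : int, `|x - k%:~R| <= `|x - j%:~R|.
  have key (j : int) : (j%:~R <= (Num.floor x)%:~R :> R) \/
                       ((Num.floor x)%:~R + 1 <= j%:~R :> R).
    have [jle|jgt] := leP j (Num.floor x); first by left; rewrite ler_int.
    by right; rewrite -[1]/(1%:~R) -intrD ler_int -ltzD1 ltrD2r.
  have [m|m] := leP (x - (Num.floor x)%:~R) ((Num.floor x)%:~R + 1 - x).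
    exists (Num.floor x) => j; rewrite ger0_norm ?subr_ge0//.
    have [jl|jl] := key j.
      by rewrite ger0_norm; lra.
    by rewrite ler0_norm; lra.
  exists (Num.floor x + 1) => j; rewrite intrD -[1%:~R]/(1 : R).
  rewrite ler0_norm; last by lra.
  have [jl|jl] := key j.
    by rewrite ger0_norm; lra.
  by rewrite ler0_norm; lra.
exists k; apply/eqP; rewrite eq_le lbd /=.
apply: lb_le_inf; first by exists `|x - 0%:~R|, 0.
by move=> _ [j _ <-].
Qed.

Section ContinuedFractions.
Variable R : realType.
Implicit Types (a b : nat -> int) (x : R).

Local Notation shift a := (fun i => a i.+1).

Lemma irrational_shift x (k : int) :
  irrational x -> irrational (x - k%:~R)^-1.
Proof.
move=> ix [q _ qx]; apply: ix; exists (q^-1 + k%:~R) => //.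
by rewrite rmorphD /= fmorphV /= qx invrK ratr_int subrK.
Qed.

Lemma irrational_int x (k : int) : irrational x -> x != k%:~R.
Proof.
by move=> ix; apply/eqP => xk; apply: ix; exists k%:~R => //; rewrite ratr_int.
Qed.

Fixpoint gauss x n : R :=
  if n is m.+1 then gauss (x - (Num.floor x)%:~R)^-1 m else x.

Definition gauss_cf x n : int := Num.floor (gauss x n).

Lemma floor_irr x : irrational x ->
  (Num.floor x)%:~R < x < (Num.floor x)%:~R + 1.
Proof.
move=> ix; rewrite lt_neqAle eq_sym irrational_int// floor_le /=.
by have := floorD1_gt x; rewrite intrD.
Qed.

Lemma gauss_gt1 x : irrational x -> 1 < (x - (Num.floor x)%:~R)^-1.
Proof.
move=> /floor_irr /andP[h1 h2]; rewrite invf_gt1; lra.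
Qed.

Lemma gauss_cf_simple x : irrational x -> is_simple_cf (gauss_cf x).
Proof.
move=> + i; elim: i x => [|i IH] x ix /=.
  by rewrite /gauss_cf /= floor_gt0 ltW// gauss_gt1.
exact: IH (@irrational_shift x (Num.floor x) ix).
Qed.

Lemma convergent_ge1 a n : (forall i, 0 < a i) -> 1 <= convergent R a n.
Proof.
elim: n a => [|n IH] a ap /=; first by rewrite ler1z -gtz0_ge1.
rewrite ler_wpDr ?ler1z -?gtz0_ge1//.
by rewrite invr_ge0 (le_trans _ (IH _ _)).
Qed.

Lemma gauss_cf_dist x n : irrational x ->
  `|convergent R (gauss_cf x) n - x| <= 2 * 2^-1 ^+ n.
Proof.
elim: n {-2}n (leqnn n) x => [|N IH] n.
  rewrite leqn0 => /eqP -> x /floor_irr /andP[h1 h2].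
  by rewrite /= /gauss_cf /= expr0 ler_norml; lra.
case: n => [|[|n]] nN x ix.
- move/floor_irr : ix => /andP[h1 h2].
  by rewrite /= /gauss_cf /= expr0 ler_norml; lra.
- have ix1 := @irrational_shift x (Num.floor x) ix.
  have y1 : 1 < gauss x 1 by exact: gauss_gt1.
  have a1 : (1 : R) <= (gauss_cf x 1)%:~R.
    by rewrite ler1z -gtz0_ge1 gauss_cf_simple.
  have ex : x = (gauss_cf x 0)%:~R + (gauss x 1)^-1.
    by rewrite /gauss_cf /= invrK [RHS]addrC subrK.
  have p1 : 0 < ((gauss_cf x 1)%:~R^-1 : R) <= 1.
    by rewrite invr_gt0 invf_le1 ?(lt_le_trans ltr01 a1)//; apply/andP; split; lra.
  have p2 : 0 < (gauss x 1)^-1 <= 1.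
    by rewrite invr_gt0 invf_le1 ?(lt_trans ltr01 y1)// (ltW y1).
  rewrite [X in _ - X]ex [convergent _ _ _]/= expr1.
  move: p1 p2.
  move=> /andP[? ?] /andP[? ?].
  by rewrite ler_norml; apply/andP; split; lra.
- have ix1 := @irrational_shift x (Num.floor x) ix.
  have ix2 := @irrational_shift _ (Num.floor (x - (Num.floor x)%:~R)^-1) ix1.
  have uv : `|convergent R (gauss_cf (gauss x 2)) n - gauss x 2| <=
      2 * 2^-1 ^+ n by exact: IH n (ltnW nN) _ ix2.
  have v1 : 1 < gauss x 2 by exact: gauss_gt1.
  have a1 : (1 : R) <= (gauss_cf x 1)%:~R.
    by rewrite ler1z -gtz0_ge1 gauss_cf_simple.
  have u1 : 1 <= convergent R (gauss_cf (gauss x 2)) n.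
    by apply: convergent_ge1 => i; apply: (gauss_cf_simple ix i.+1).
  have -> : convergent R (gauss_cf x) n.+2 = (gauss_cf x 0)%:~R +
      ((gauss_cf x 1)%:~R + (convergent R (gauss_cf (gauss x 2)) n)^-1)^-1.
    by [].
  have e1 : gauss x 1 = (gauss_cf x 1)%:~R + (gauss x 2)^-1.
    by rewrite /gauss_cf /= invrK [RHS]addrC subrK.
  have ex : x = (gauss_cf x 0)%:~R + ((gauss_cf x 1)%:~R + (gauss x 2)^-1)^-1.
    by rewrite -e1 /gauss_cf /= invrK [RHS]addrC subrK.
  rewrite [X in _ - X]ex.
  move: (gauss x 2) (convergent R (gauss_cf (gauss x 2)) n) v1 u1 uv
    ((gauss_cf x 1)%:~R) a1 => v u v1 u1 uv c c1.
  have -> : (gauss_cf x 0)%:~R + (c + u^-1)^-1 -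
            ((gauss_cf x 0)%:~R + (c + v^-1)^-1) =
            (u - v) / ((c * u + 1) * (c * v + 1)).
    field.
    by rewrite !lt0r_neq0//; nra.
  have d4 : 4 <= (c * u + 1) * (c * v + 1).
    have : 1 <= c * u by nra.
    have : 1 <= c * v by nra.
    by nra.
  rewrite normrM normfV (ger0_norm (le_trans _ d4))//.
  rewrite ler_pdivrMr; last by lra.
  rewrite !exprS.
  have : 0 < 2^-1 ^+ n :> R by rewrite exprn_gt0// invr_gt0.
  move: (2^-1 ^+ n) uv ((c * u + 1) * (c * v + 1)) d4 => t uv D D4 t0.
  have : t * 4 <= t * D by rewrite ler_pM2l.
  by lra.
Qed.

Lemma gauss_cf_expansion x : irrational x -> is_cf_expansion (gauss_cf x) x.
Proof.
move=> ix; split; first exact: gauss_cf_simple.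
apply/cvgrPdist_le => e e0.
have h : geometric 2 (2^-1 : R) @ \oo --> (0 : R).
  by apply: cvg_geometric; rewrite ger0_norm ?invr_ge0// invf_lt1// ltr1n.
move/cvgrPdist_le : h => /(_ e e0); apply: filterS => n.
rewrite sub0r normrN => h; rewrite distrC.
by apply: le_trans (gauss_cf_dist n ix) (le_trans (ler_norm _) h).
Qed.

Lemma is_cf_expansion_shift a x : irrational x -> is_cf_expansion a x ->
  a 0%N = Num.floor x /\
  is_cf_expansion (shift a) (x - (Num.floor x)%:~R)^-1.
Proof.
move=> ix [ap ax].
have cS : (fun n => (a 0%N)%:~R + (convergent R (shift a) n)^-1) @ \oo --> x.
  by have := ax; rewrite -cvg_shiftS.
have c1 n : 1 <= convergent R (shift a) n by apply: convergent_ge1.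
have lb : (a 0%N)%:~R <= x.
  apply: (cvgr_to_ge cS); near=> n.
  by rewrite lerDl invr_ge0 (le_trans _ (c1 n)).
have ub : x <= (a 0%N)%:~R + 1.
  apply: (cvgr_to_le cS); near=> n.
  by rewrite lerD2l invf_le1 ?c1// (lt_le_trans _ (c1 n)).
have a0 : a 0%N = Num.floor x.
  apply/esym/floor_def; rewrite lb intrD lt_neqAle ub andbT.
  by rewrite -[1]/(1%:~R) -intrD irrational_int.
split=> //; split; first by move=> i; apply: ap.
rewrite -a0.
have d : (fun n => (convergent R (shift a) n)^-1) @ \oo --> x - (a 0%N)%:~R.
  rewrite (_ : (fun n => _) = (fun n => (a 0%N)%:~R +
      (convergent R (shift a) n)^-1 - (a 0%N)%:~R)).
    exact: cvgB cS (cvg_cst _).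
  by apply/funext => n; rewrite addrAC subrr add0r.
have nz : x - (a 0%N)%:~R != 0 by rewrite subr_eq0 irrational_int.
rewrite (_ : convergent R (shift a) =
  (fun n => (convergent R (shift a) n)^-1^-1)); first exact: cvgV nz d.
by apply/funext => n; rewrite invrK.
Unshelve. all: by end_near. Qed.

Lemma cf_expansion_unique x a b : irrational x ->
  is_cf_expansion a x -> is_cf_expansion b x -> a = b.
Proof.
move=> ix ax bx; apply/funext => i.
elim: i x ix a ax b bx => [|i IH] x ix a ax b bx;
  have [a0 sa] := is_cf_expansion_shift ix ax;
  have [b0 sb] := is_cf_expansion_shift ix bx; first by rewrite a0.
exact: (IH _ (@irrational_shift x _ ix) _ sa _ sb).
Qed.

Lemma cf_expansionP x : irrational x -> is_cf_expansion (cf_expansion x) x.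
Proof.
move=> ix.
apply: (@xgetPex _ (fun=> 0) [set a | is_cf_expansion a x]).
by exists (gauss_cf x); apply: gauss_cf_expansion.
Qed.

Lemma cf_tail_expansion x n : irrational x ->
  irrational (cf_tail x n) /\
  is_cf_expansion (fun i => cf_expansion x (n + i)%N) (cf_tail x n).
Proof.
move=> ix.
suff [y [iy ey]] : exists y : R, irrational y /\
    is_cf_expansion (fun i => cf_expansion x (n + i)%N) y.
  by rewrite /cf_tail /cf_value; have -> := cvg_lim (@Rhausdorff R) ey.2.
elim: n => [|n [y [iy ey]]]; first by exists x; split=> //; apply: cf_expansionP.
exists (y - (Num.floor y)%:~R)^-1; split; first exact: irrational_shift.
have [_] := is_cf_expansion_shift iy ey.
by under [X in is_cf_expansion X]eq_fun do rewrite addnS -addSn.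
Qed.

End ContinuedFractions.

(* Main.v *)
Require Import Defs.
From mathcomp Require Import all_boot all_order all_algebra.
From mathcomp Require Import ring lra.
From mathcomp Require Import all_classical all_reals all_analysis.

(** The tails of [x] are reached from [x] by finitely many Gauss steps
    [y |-> (y - floor y)^-1], so it is enough that the type is unchanged by
    translation by an integer and by inversion.

    Translating [x] by an integer [k] translates [q x] by the integer [q k],
    and so does not change the distance from [q x] to the nearest integer.

    For inversion, a good approximation [q x ~ p] is, after division by [x],
    a good approximation [p x^-1 ~ q]. The error is divided by the constant
    [|x|], and the new denominator [|p|] is comparable to [q]: for large [q]
    it lies between [q |x| / 2] and [2 q |x|]. Hence [|p|^theta] is at most a
    constant times [q^theta], and every exponent [theta] with lower limit [0]
    for [x] also has lower limit [0] for [x^-1] ([irr_type_inv]). *)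

Set Implicit Arguments.
Unset Strict Implicit.
Unset Printing Implicit Defensive.

Import Order.TTheory GRing.Theory Num.Theory.
Import numFieldNormedType.Exports.

Local Open Scope classical_set_scope.
Local Open Scope ring_scope.

Lemma limn_einf_eq0P (R : realType) (u : nat -> R) : (forall q, 0 <= u q) ->
  limn_einf (fun q => (u q)%:E) = 0%E <->
  forall (e : R) (N : nat), 0 < e -> exists2 q : nat, (N <= q)%N & u q < e.
Proof.
move=> u0.
rewrite limn_einf_lim (cvg_lim _ (@cvg_einfs_sup _ _))//.
split=> [s0 e N e0|h].
  have : (einfs (fun q => (u q)%:E) N < e%:E)%E.
    apply: (@le_lt_trans _ _ 0%E); last by rewrite lte_fin.
    by rewrite -s0; apply: ereal_sup_ubound; exists N.
  rewrite /einfs /= => /ereal_inf_lt[_ [q /= Nq <-]].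
  by rewrite lte_fin; exists q.
apply/eqP; rewrite eq_le; apply/andP; split.
  apply: ge_ereal_sup => _ [N _ <-]; apply/lee_addgt0Pr => e e0.
  have [q Nq uq] := h e N e0.
  rewrite add0e (@le_trans _ _ (u q)%:E)//; last by rewrite lee_fin ltW.
  by apply: ereal_inf_lbound; exists q.
apply: (@le_trans _ _ (einfs (fun q => (u q)%:E) 0%N)).
  by apply: le_ereal_inf_tmp => _ [q _ <-]; rewrite lee_fin.
by apply: ereal_sup_ubound; exists 0%N.
Qed.

Section Approximation.
Variable R : realType.
Implicit Types (x theta : R) (q : nat) (k : int).

(** The sequences in the definition of [irr_type] are nonnegative, so a zero
    lower limit says that arbitrarily good approximations occur beyond every
    bound. *)
Definition well_approximable x theta := forall (e : R) (N : nat), 0 < e ->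
  exists2 q : nat, (N <= q)%N & q%:R `^ theta * dist_int (q%:R * x) < e.

Lemma dist_int_ge0 x : 0 <= dist_int x.
Proof. by have [[k ->] _] := dist_int_min x. Qed.

Lemma dist_int_le1 x : dist_int x <= 1.
Proof.
have [_ /(_ (Num.floor x)) /le_trans] := dist_int_min x; apply.
have := floor_le x; have := floorD1_gt x; rewrite intrD ler_norml.
by move=> ? ?; apply/andP; split; lra.
Qed.

Lemma irr_typeE x :
  irr_type x = ereal_sup [set theta%:E | theta in well_approximable x].
Proof.
rewrite /irr_type; congr (ereal_sup (_ @` _)).
apply/seteqP; split=> theta /=.
  by move/limn_einf_eq0P; apply => q; rewrite mulr_ge0 ?powR_ge0 ?dist_int_ge0.
by move=> h; apply/limn_einf_eq0P => // q;
  rewrite mulr_ge0 ?powR_ge0 ?dist_int_ge0.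
Qed.

Lemma dist_intBz x k : dist_int (x - k%:~R) = dist_int x.
Proof.
rewrite /dist_int; congr inf; apply/seteqP; split=> _ [j _ <-] /=.
  by exists (k + j) => //; rewrite intrD opprD addrA.
by exists (j - k) => //; rewrite intrB opprB addrA subrK.
Qed.

Lemma irr_typeBz x k : irr_type (x - k%:~R) = irr_type x.
Proof.
suff dE q : dist_int (q%:R * (x - k%:~R)) = dist_int (q%:R * x).
  by rewrite /irr_type; under eq_set do under eq_fun do rewrite dE.
by rewrite mulrBr -[q%:R * k%:~R]/(q%:~R * _) -intrM dist_intBz.
Qed.

(** Bounding by the sum of the endpoint values treats exponents of both signs
    at once. *)
Lemma powR_itv_le (c C r theta : R) : 0 < c -> c <= r <= C ->
  r `^ theta <= c `^ theta + C `^ theta.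
Proof.
move=> c0 /andP[cr rC].
have r0 : 0 < r by exact: lt_le_trans cr.
have C0 : 0 < C by exact: lt_le_trans rC.
have [t0|/ltW t0] := leP 0 theta.
  by rewrite ler_wpDl ?powR_ge0// ge0_ler_powR// nnegrE ltW.
rewrite ler_wpDr ?powR_ge0// -[theta]opprK !(powRN _ (- theta)).
rewrite lef_pV2 ?posrE ?powR_gt0//.
by rewrite ge0_ler_powR ?oppr_ge0// nnegrE ltW.
Qed.

Lemma well_approximable_inv x theta : x != 0 ->
  well_approximable x theta -> well_approximable x^-1 theta.
Proof.
move=> xn0 h e N e0.
have x0 : 0 < `|x| by rewrite normr_gt0.
pose M := (`|x| / 2) `^ theta + (`|x| * 2) `^ theta.
have M0 : 0 < M by rewrite addr_gt0// powR_gt0// ?divr_gt0 ?mulr_gt0.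
have e'0 : 0 < e * `|x| / M by rewrite divr_gt0// mulr_gt0.
(* Beyond this bound, [q |x|] is at least [2 (N + 1)]: this absorbs the error
   [1] in [|p| ~ q |x|] and makes [|p|] at least [N]. *)
pose K := (Num.truncn (2 * N.+1%:R / `|x|)).+1.
have [q Kq qe] := h _ K e'0.
have qK : 2 * N.+1%:R <= q%:R * `|x|.
  rewrite -ler_pdivrMr//; apply: le_trans (_ : K%:R <= _); last by rewrite ler_nat.
  exact/ltW/truncnS_gt.
have N1 : N.+1%:R = N%:R + 1 :> R by rewrite -natr1.
have N0 : 0 <= N%:R :> R by [].
have q0 : 0 < q%:R :> R.
  by rewrite -(pmulr_lgt0 _ x0); lra.
have [[p pE] _] := dist_int_min (q%:R * x).
have d1 := dist_int_le1 (q%:R * x).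
have aE : `|p|%N%:R = `|p%:~R| :> R.
  by rewrite -[LHS]/((Posz `|p|%N)%:~R) abszE intr_norm.
have [plo phi] : q%:R * `|x| / 2 <= `|p%:~R| :> R /\
    `|p%:~R| <= q%:R * `|x| * 2 :> R.
  have qx : `|q%:R * x| = q%:R * `|x| by rewrite normrM ger0_norm// ltW.
  have := lerB_dist (q%:R * x) p%:~R; rewrite qx -pE => ?.
  have := lerB_dist p%:~R (q%:R * x); rewrite qx distrC -pE => ?.
  by split; lra.
exists `|p|%N.
  by rewrite -(ler_nat R) aE; apply: le_trans plo; lra.
rewrite aE.
have rE : `|p%:~R| = (`|p%:~R| / q%:R) * q%:R :> R.
  by rewrite divfK// gt_eqF.
have rM : `|p%:~R| `^ theta <= M * q%:R `^ theta.
  rewrite rE powRM ?divr_ge0 ?(ltW q0)// ler_wpM2r ?powR_ge0//.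
  apply: powR_itv_le; first by rewrite divr_gt0.
  by rewrite ler_pdivlMr// ler_pdivrMr//; apply/andP; split; lra.
have dM : dist_int (`|p%:~R| * x^-1) <= dist_int (q%:R * x) / `|x|.
  have dE : `|p%:~R * x^-1 - q%:R| = dist_int (q%:R * x) / `|x|.
    by rewrite pE distrC -normfV -normrM mulrBl mulfK.
  have [p0|p0] := ger0P (p%:~R : R).
    by have [_ /(_ (Posz q))] := dist_int_min (p%:~R * x^-1); rewrite dE.
  have [_ /(_ (- Posz q))] := dist_int_min (- p%:~R * x^-1).
  by rewrite intrN mulNr -opprD normrN dE.
apply: le_lt_trans (_ : M * q%:R `^ theta * (dist_int (q%:R * x) / `|x|) < _).
  by rewrite ler_pM ?powR_ge0 ?dist_int_ge0.
rewrite mulrA ltr_pdivrMr// -mulrA mulrC.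
by rewrite -ltr_pdivlMr.
Qed.

Lemma irr_type_inv x : irr_type x^-1 = irr_type x.
Proof.
have [->|x0] := eqVneq x 0; first by rewrite invr0.
rewrite !irr_typeE; congr (ereal_sup (_ @` _)).
apply/seteqP; split=> theta; last exact: well_approximable_inv.
by rewrite -{2}[x]invrK; apply: well_approximable_inv; rewrite invr_eq0.
Qed.

(** By induction on [n], moving the expansion of [x] to that of its Gauss step;
    hence the statement is about an arbitrary expansion [a] of [x]. *)
Lemma irr_type_cf_value (a : nat -> int) x (n : nat) :
  irrational x -> is_cf_expansion a x ->
  irr_type (cf_value R (fun i => a (n + i)%N)) = irr_type x.
Proof.
elim: n a x => [|n IH] a x ix ax.
  by rewrite /cf_value (cvg_lim _ ax.2).
have [_ sax] := is_cf_expansion_shift ix ax.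
have := IH _ _ (irrational_shift (k := Num.floor x) ix) sax.
by rewrite irr_type_inv irr_typeBz.
Qed.

End Approximation.

Theorem corollary3p7 (R : realType) (alpha beta : R) (m n : nat)
    (halpha : irrational alpha) (hbeta : irrational beta)
    (htail : cf_tail alpha m = cf_tail beta n) :
  irr_type alpha = irr_type beta.
Proof.
rewrite -(irr_type_cf_value m halpha (cf_expansionP halpha)).
rewrite -(irr_type_cf_value n hbeta (cf_expansionP hbeta)).
by congr irr_type.
Qed.
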